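(* Algorithm local-ratio described in the context, called initially on $\vec\sigma=(0,\dots,0)$ and $\vec g=(f_1,\dots,f_n)$, runs in time polynomial in $n$ and $T$ (pseudo-polynomial time) and returns a feasible due date assignment $\vec\rho$ such that any schedule in which every job $j$ completes by $\rho_j$ (e.g. the schedule processing the jobs without idle time in nondecreasing order of $\rho_j$) has cost at most four times the optimal cost of the instance of $1||\sum f_j$; that is, it is a pseudo-polynomial time 4-approximation algorithm for $1||\sum f_j$.
   Context: Problem $1||\sum f_j$: a set $\mathcal{J}=\{1,\dots,n\}$ of jobs, each with a positive integer processing time $p_j$ and a nondecreasing cost function $f_j$ with nonnegative integer values; jobs are processed one at a time without preemption on a single machine; $C_j$ is the completion time; minimize $\sum_jf_j(C_j)$. Let $T=\sum_jp_j$, $\mathcal{T}=\{1,\dots,T\}$, and extend each $f_j$ by $f_j(0)=0$. A due date assignment is a vector $\vec\sigma\in(\mathcal{T}\cup\{0\})^n$; it is feasible if there is a schedule in which every job $j$ completes by time $\sigma_j$. Write $(\vec\sigma_{-j},s)$ for $\vec\sigma$ with the $j$-th entry replaced by $s$. Let $A^{\vec\sigma}_t=\{j:\sigma_j\ge t\}$, $D(t,\vec\sigma)=\max\{T-t+1-\sum_{j\in A^{\vec\sigma}_t}p_j,0\}$ and $p_j(t,\vec\sigma)=\min\{p_j,D(t,\vec\sigma)\}$. Algorithm local-ratio$(\vec\sigma,\vec g)$, where $\vec g=(g_1,\dots,g_n)$ are functions $\mathcal{T}\cup\{0\}\to\mathbb{R}_{\ge0}$: if $\vec\sigma$ is feasible,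 return $\vec\rho=\vec\sigma$. Otherwise let $t^*\in\arg\max_{t\in\mathcal{T}}D(t,\vec\sigma)$ (ties broken arbitrarily); for each $i\in\mathcal{J}$ define $\widehat g_i(t)=p_i(t^*,\vec\sigma)$ if $\sigma_i<t^*\le t$ and $\widehat g_i(t)=0$ otherwise; let $\alpha$ be the largest value such that $\widetilde g=\vec g-\alpha\widehat g\ge 0$ pointwise; choose $j,s$ with $\widetilde g_j(s)=0$ and $\widehat g_j(s)>0$; set $\widetilde\sigma=(\vec\sigma_{-j},s)$ and $\widetilde\rho=$ local-ratio$(\widetilde\sigma,\widetilde g)$. If $(\widetilde\rho_{-j},\sigma_j)$ is feasible, return $\vec\rho=(\widetilde\rho_{-j},\sigma_j)$; otherwise return $\vec\rho=\widetilde\rho$. *)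

(* Defs.v *)
From mathcomp Require Import all_boot all_order all_fingroup all_algebra.

Set Implicit Arguments.
Unset Strict Implicit.
Unset Printing Implicit Defensive.

Import Order.TTheory GRing.Theory Num.Theory.

Local Open Scope nat_scope.

(* f j is already extended to time 0 by f j 0 = 0. *)
Definition valid_instance (n : nat) (p : 'I_n -> nat) (f : 'I_n -> nat -> nat)
    : Prop :=
  [/\ forall j, 0 < p j,
      forall j, {homo f j : s t / s <= t}
    & forall j, f j 0 = 0].

Section Scheduling.

Variables (n : nat) (p : 'I_n -> nat).

Definition horizon : nat := \sum_j p j.

(* {0, ..., T}; the elements of {1, ..., T} are the t : time with 0 < t. *)
Definition time := 'I_horizon.+1.

(* A schedule is given by its start times. *)
Definition is_schedule (S : 'I_n -> nat) : Prop :=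
  forall i j, i != j -> S i + p i <= S j \/ S j + p j <= S i.

Definition completion (S : 'I_n -> nat) (j : 'I_n) : nat := S j + p j.

Definition sched_cost (f : 'I_n -> nat -> nat) (S : 'I_n -> nat) : nat :=
  \sum_j f j (completion S j).

Definition optimal_cost (f : 'I_n -> nat -> nat) (opt : nat) : Prop :=
  (exists2 S, is_schedule S & sched_cost f S = opt) /\
  (forall S, is_schedule S -> opt <= sched_cost f S).

Definition assignment := {ffun 'I_n -> time}.

Definition meets (S : 'I_n -> nat) (sigma : assignment) : Prop :=
  forall j, completion S j <= sigma j.

Definition feasible (sigma : assignment) : Prop :=
  exists2 S, is_schedule S & meets S sigma.

Definition update (sigma : assignment) (j : 'I_n) (s : time) : assignment :=
  [ffun i => if i == j then s else sigma i].

(* pos j is the position of job j; jobs are processed without idle time. *)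
Definition list_schedule (pos : {perm 'I_n}) (j : 'I_n) : nat :=
  \sum_(i | pos i < pos j) p i.

Definition due_date_order (rho : assignment) (pos : {perm 'I_n}) : Prop :=
  forall i j, pos i < pos j -> rho i <= rho j.

(* The maximum with 0 is the truncation of the subtraction on nat. *)
Definition demand (t : time) (sigma : assignment) : nat :=
  (horizon - t + 1) - \sum_(j | t <= sigma j) p j.

Definition trunc_p (j : 'I_n) (t : time) (sigma : assignment) : nat :=
  minn (p j) (demand t sigma).

Variable R : realFieldType.

Definition costs := 'I_n -> time -> R.

Definition ghat (sigma : assignment) (tstar : time) : costs :=
  fun i t => if (sigma i < tstar) && (tstar <= t)
             then ((trunc_p i tstar sigma)%:R)%R else 0%R.

Definition nonneg_costs (g : costs) : Prop := forall i t, (0 <= g i t)%R.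

Definition residual (g h : costs) (alpha : R) : costs :=
  fun i t => (g i t - alpha * h i t)%R.

Definition largest_multiplier (g h : costs) (alpha : R) : Prop :=
  nonneg_costs (residual g h alpha) /\
  (forall beta, nonneg_costs (residual g h beta) -> (beta <= alpha)%R).

Definition is_argmax_demand (sigma : assignment) (tstar : time) : Prop :=
  0 < tstar /\ forall t : time, 0 < t -> demand t sigma <= demand tstar sigma.

(* One non-terminal call on (sigma, g): for some admissible resolution of the
   ties, job j and time s are chosen and the recursive call is made on
   (update sigma j s, g'). *)
Definition lr_step (sigma : assignment) (g : costs) (j : 'I_n) (s : time)
    (g' : costs) : Prop :=
  ~ feasible sigma /\
  exists (tstar : time) (alpha : R),
    [/\ is_argmax_demand sigma tstar,
        largest_multiplier g (ghat sigma tstar) alpha,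
        forall i t, g' i t = residual g (ghat sigma tstar) alpha i t,
        g' j s = 0%R
      & (0 < ghat sigma tstar j s)%R].

(* local_ratio sigma g rho: some execution on (sigma, g) returns rho. *)
Inductive local_ratio : assignment -> costs -> assignment -> Prop :=
| LR_done sigma g :
    feasible sigma -> local_ratio sigma g sigma
| LR_restore sigma g j s g' rho :
    lr_step sigma g j s g' ->
    local_ratio (update sigma j s) g' rho ->
    feasible (update rho j (sigma j)) ->
    local_ratio sigma g (update rho j (sigma j))
| LR_keep sigma g j s g' rho :
    lr_step sigma g j s g' ->
    local_ratio (update sigma j s) g' rho ->
    ~ feasible (update rho j (sigma j)) ->
    local_ratio sigma g rho.

(* Whatever choices are made, local-ratio on (sigma, g) never gets stuck and
   terminates after at most k (nested) calls. *)
Fixpoint halts_within (k : nat) (sigma : assignment) (g : costs) : Prop :=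
  if k is k'.+1 then
    feasible sigma \/
    (exists j s g', lr_step sigma g j s g') /\
    (forall j s g', lr_step sigma g j s g' ->
       halts_within k' (update sigma j s) g')
  else False.

Definition sigma_init : assignment := [ffun=> ord0].

Definition costs_init (f : 'I_n -> nat -> nat) : costs :=
  fun j t => ((f j t)%:R)%R.

End Scheduling.

(* Running time is measured on an imperative language whose memory consists of
   numbered two-dimensional arrays of naturals and of elements of R.  Each
   assignment and each test costs one unit: expressions have a size bounded by
   the program, so charging for every operation changes the time only by a
   constant factor.
   Unit cost is realistic here: elements of R can only be added, subtracted,
   compared, multiplied or divided by a natural, and naturals can only be added
   and subtracted.  From naturals with at most b bits in the input, k steps of
   a fixed program can thus only build naturals of O(b + k) bits and rationals
   with numerator and denominator of O((k + 1) (b + k)) bits, so that the number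
   of steps is polynomially related to the bit complexity. *)
Inductive nexp : Type :=
| NLit of nat
| NGet of nat & nexp & nexp
| NAdd of nexp & nexp
| NSub of nexp & nexp.

Inductive rexp : Type :=
| RGet of nat & nexp & nexp
| RAdd of rexp & rexp
| RSub of rexp & rexp
| RMul of rexp & nexp
| RDiv of rexp & nexp.

Inductive test : Type :=
| NLe of nexp & nexp
| RLe of rexp & rexp.

Inductive cmd : Type :=
| Skip
| NSet of nat & nexp & nexp & nexp
| RSet of nat & nexp & nexp & rexp
| Seq of cmd & cmd
| If of test & cmd & cmd
| While of test & cmd.

Section Machine.

Variable R : realFieldType.

Record memory := Memory {
  nmem : nat -> nat -> nat -> nat;
  rmem : nat -> nat -> nat -> R
}.

Fixpoint neval (m : memory) (e : nexp) : nat :=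
  match e with
  | NLit k => k
  | NGet a e1 e2 => nmem m a (neval m e1) (neval m e2)
  | NAdd e1 e2 => neval m e1 + neval m e2
  | NSub e1 e2 => neval m e1 - neval m e2
  end.

Fixpoint reval (m : memory) (e : rexp) : R :=
  match e with
  | RGet a e1 e2 => rmem m a (neval m e1) (neval m e2)
  | RAdd e1 e2 => (reval m e1 + reval m e2)%R
  | RSub e1 e2 => (reval m e1 - reval m e2)%R
  | RMul e1 e2 => (reval m e1 * (neval m e2)%:R)%R
  | RDiv e1 e2 => (reval m e1 / (neval m e2)%:R)%R
  end.

Definition teval (m : memory) (b : test) : bool :=
  match b with
  | NLe e1 e2 => neval m e1 <= neval m e2
  | RLe e1 e2 => (reval m e1 <= reval m e2)%R
  end.

Definition write (T : Type) (mem : nat -> nat -> nat -> T) (a i j : nat)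
    (x : T) : nat -> nat -> nat -> T :=
  fun a' i' j' =>
    if [&& a' == a, i' == i & j' == j] then x else mem a' i' j'.

(* exec c m m' k: c started in memory m halts in memory m' after k steps.
   The language is deterministic, so m' and k are determined by c and m. *)
Inductive exec : cmd -> memory -> memory -> nat -> Prop :=
| ExecSkip m : exec Skip m m 1
| ExecNSet m a e1 e2 e :
    exec (NSet a e1 e2 e) m
      (Memory (write (nmem m) a (neval m e1) (neval m e2) (neval m e)) (rmem m))
      1
| ExecRSet m a e1 e2 e :
    exec (RSet a e1 e2 e) m
      (Memory (nmem m) (write (rmem m) a (neval m e1) (neval m e2) (reval m e)))
      1
| ExecSeq c1 c2 m m1 m2 k1 k2 :
    exec c1 m m1 k1 -> exec c2 m1 m2 k2 -> exec (Seq c1 c2) m m2 (k1 + k2)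
| ExecIfT b c1 c2 m m' k :
    teval m b -> exec c1 m m' k -> exec (If b c1 c2) m m' k.+1
| ExecIfF b c1 c2 m m' k :
    ~~ teval m b -> exec c2 m m' k -> exec (If b c1 c2) m m' k.+1
| ExecWhileT b c m m1 m2 k1 k2 :
    teval m b -> exec c m m1 k1 -> exec (While b c) m1 m2 k2 ->
    exec (While b c) m m2 (k1 + k2).+1
| ExecWhileF b c m :
    ~~ teval m b -> exec (While b c) m m 1.

(* Input: n in cell (0, 0) of array 0 and p_j in cell (j, 0) of array 1 of the
   natural memory, f_j(t) in cell (j, t) of array 0 of the R memory for
   0 <= t <= T; all other cells are zero. *)
Definition input (n : nat) (p : 'I_n -> nat) (f : 'I_n -> nat -> nat) : memory :=
  Memory
    (fun a i k =>
       match a, k with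
       | 0, 0 => if i == 0 then n else 0
       | 1, 0 => if insub i is Some j then p j else 0
       | _, _ => 0
       end)
    (fun a i t =>
       if (a == 0) && (t <= horizon p) then
         if insub i is Some j then ((f j t)%:R)%R else 0%R
       else 0%R).

(* Output: the vector x in the cells (j, 0) of array a. *)
Definition outputs (m : memory) (a : nat) (n : nat) (x : 'I_n -> nat) : Prop :=
  forall j : 'I_n, nmem m a j 0 = x j.

End Machine.

(* Main.v *)
(* An assignment is feasible iff every demand is zero, so each step of local-ratio
   raises a due date below a time of maximal demand, and there are at most nT
   steps.

   A step subtracts from the costs a multiple of ghat.  Every feasible assignment
   pays at least D := D(t*, sigma) under ghat (knapsack cover).  The returned rho
   pays at most 4 D: a job i with sigma_i < t* <= rho_i cannot be restored to
   sigma_i, hence has a critical time at which rho covers the demand only thanks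
   to i.  Separate these jobs according to whether this time is before t*; in
   each class the jobs other than the one with an extremal critical time have
   total size below the demand at that time, which is at most D, and that one job
   adds at most D.  Adding up the steps gives the factor 4.

   The program replaces the recursion by a loop which stores the chosen jobs and
   their old due dates on a stack, and a second loop which pops the stack and
   tries to restore the due dates. *)

Require Import Defs.
From mathcomp Require Import all_boot all_order all_fingroup all_algebra.
From mathcomp Require Import zify.

Set Implicit Arguments.
Unset Strict Implicit.
Unset Printing Implicit Defensive.

Import Order.TTheory GRing.Theory Num.Theory.

Local Open Scope nat_scope.

(** * The algorithm *)

Section Feasibility.

Variables (n : nat) (p : 'I_n -> nat).

Lemma sum_indicator_interval t a q :
  \sum_(x < t) (a <= x < a + q) = minn t (a + q) - minn t a.
Proof.
elim: t => [|t IHt]; first by rewrite big_ord0; lia.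
by rewrite big_ord_recr /= IHt; lia.
Qed.

(** Double counting over the unit slots [x < t]: a job of [P] fills [p j] of them, and each slot is
    filled by at most one job because jobs do not overlap. *)
Lemma schedule_load (S : 'I_n -> nat) (P : pred 'I_n) (t : nat) :
  is_schedule p S -> (forall j, P j -> completion p S j <= t) ->
  \sum_(j | P j) p j <= t.
Proof.
move=> schedS leSt.
have -> : \sum_(j | P j) p j =
    \sum_(j | P j) \sum_(x < t) (S j <= x < S j + p j).
  apply: eq_bigr => j Pj; rewrite sum_indicator_interval.
  by have := leSt j Pj; rewrite /completion; lia.
rewrite exchange_big /= -[X in _ <= X]card_ord -sum1_card.
apply: leq_sum => x _.
case: (pickP (fun j => P j && (S j <= x < S j + p j))) => [j /andP[Pj jx]|noj].
  rewrite (bigD1 j) //= jx big1 // => i /andP[_ ij].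
  by apply/eqP; rewrite eqb0; have := schedS i j ij; lia.
by rewrite big1 // => j Pj; have := noj j; rewrite Pj /= => ->.
Qed.

(** If [r i j], then [i] and all its predecessors precede [j], so [j] starts after [i] ends. The
    order is kept abstract to cover both [due_date_lt] and the positions of a permutation. *)
Lemma order_schedule_disjoint (r : rel 'I_n) :
  transitive r -> irreflexive r -> (forall i j, i != j -> r i j || r j i) ->
  is_schedule p (fun j => \sum_(i | r i j) p i).
Proof.
move=> r_tr r_irr r_tot.
have before i j : r i j ->
    \sum_(k | r k i) p k + p i <= \sum_(k | r k j) p k.
  move=> rij; rewrite (bigD1 (P := fun k => r k j) i) //= addnC leq_add2l.
  rewrite [X in _ <= X]big_mkcond [X in X <= _]big_mkcond; apply: leq_sum => k _.
  case: ifP => // rki; rewrite (r_tr _ _ _ rki rij) /=.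
  by case: eqP => // ki; rewrite ki r_irr in rki.
by move=> i j /r_tot /orP[] /before; [left | right].
Qed.

Lemma order_schedule_completion (r : rel 'I_n) (d : 'I_n -> nat) (j : 'I_n) :
  irreflexive r -> (forall i, r i j -> d i <= d j) ->
  \sum_(i | d i <= d j) p i <= d j ->
  completion p (fun j => \sum_(i | r i j) p i) j <= d j.
Proof.
move=> r_irr r_mono; apply: leq_trans.
rewrite /completion (bigD1 (P := fun i => d i <= d j) j) //= addnC leq_add2l.
rewrite [X in _ <= X]big_mkcond [X in X <= _]big_mkcond; apply: leq_sum => i _.
case: ifP => // rij; rewrite (r_mono _ rij) /=.
by case: eqP => // ij; rewrite ij r_irr in rij.
Qed.

(* Nondecreasing due dates, ties broken by index. *)
Definition due_date_lt (d : 'I_n -> nat) : rel 'I_n :=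
  fun i j => d i + (j <= i) <= d j.

Definition due_date_schedule (d : 'I_n -> nat) : 'I_n -> nat :=
  fun j => \sum_(i | due_date_lt d i j) p i.

Lemma due_date_lt_irr d : irreflexive (due_date_lt d).
Proof. by move=> i; rewrite /due_date_lt; lia. Qed.

Lemma due_date_schedule_disjoint d : is_schedule p (due_date_schedule d).
Proof.
apply: order_schedule_disjoint; last first.
- by move=> i j; rewrite /due_date_lt -val_eqE /=; lia.
- exact: due_date_lt_irr.
- by move=> i j k; rewrite /due_date_lt; lia.
Qed.

Lemma due_date_schedule_completion (d : 'I_n -> nat) j :
  \sum_(i | d i <= d j) p i <= d j ->
  completion p (due_date_schedule d) j <= d j.
Proof.
apply: order_schedule_completion => [|i]; first exact: due_date_lt_irr.
by rewrite /due_date_lt; lia.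
Qed.

Lemma horizon_split (P : pred 'I_n) :
  horizon p = \sum_(j | P j) p j + \sum_(j | ~~ P j) p j.
Proof. exact: bigID. Qed.

(** Jobs due before [t] fit into the first [t - 1] slots, so the remaining ones have total size at
    least T - t + 1. *)
Lemma feasible_demand (sigma : assignment p) (t : time p) :
  feasible sigma -> 0 < t -> demand t sigma = 0.
Proof.
case=> S schedS leS t0.
have : \sum_(j | ~~ (t <= sigma j)) p j <= t.-1.
  apply: (schedule_load schedS) => j; rewrite -ltnNge => lt_s.
  by have := leS j; lia.
have := horizon_split (fun j => t <= sigma j); have := ltn_ord t.
by rewrite /demand; lia.
Qed.

(** This is the vanishing of the demand at time [sigma j + 1]. When [sigma j] is T that time does
    not exist, but then the bound is just the total processing time. *)
Lemma demand0_load (sigma : assignment p) (j : 'I_n) :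
  (forall t : time p, 0 < t -> demand t sigma = 0) ->
  \sum_(i | sigma i <= sigma j) p i <= sigma j.
Proof.
move=> dem0; have [ltT|] := ltnP (sigma j) (horizon p); last first.
  apply: leq_trans; rewrite /horizon [X in X <= _]big_mkcond.
  by apply: leq_sum => i _; case: ifP.
have ltT' : (sigma j).+1 < (horizon p).+1 by [].
have := dem0 (Ordinal ltT') isT.
have := horizon_split (fun i => (sigma j).+1 <= sigma i).
under [X in _ = _ + X]eq_bigl do rewrite -ltnNge ltnS.
by rewrite /demand /=; lia.
Qed.

Lemma demand0_due_date_schedule (sigma : assignment p) :
  (forall t : time p, 0 < t -> demand t sigma = 0) ->
  meets (due_date_schedule (fun j => sigma j)) sigma.
Proof.
by move=> dem0 j; apply/due_date_schedule_completion/demand0_load.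
Qed.

Definition feasibleb (sigma : assignment p) : bool :=
  [forall t : time p, (0 < t) ==> (demand t sigma == 0)].

Lemma feasibleP (sigma : assignment p) :
  reflect (feasible sigma) (feasibleb sigma).
Proof.
apply: (iffP forallP) => [dem0|feas t].
  exists (due_date_schedule (fun j => sigma j)).
    exact: due_date_schedule_disjoint.
  apply: demand0_due_date_schedule => t t0.
  by have /implyP/(_ t0)/eqP := dem0 t.
by apply/implyP => t0; rewrite feasible_demand.
Qed.

Lemma infeasible_demand (sigma : assignment p) :
  ~ feasible sigma -> exists2 t : time p, 0 < t & 0 < demand t sigma.
Proof.
move/feasibleP; rewrite negb_forall => /existsP[t].
by rewrite negb_imply -lt0n => /andP[t0 dt]; exists t.
Qed.

Lemma list_schedule_feasible (rho : assignment p) (pos : {perm 'I_n}) :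
  feasible rho -> due_date_order rho pos ->
  is_schedule p (list_schedule p pos) /\ meets (list_schedule p pos) rho.
Proof.
move=> feas ord; split.
  apply: (order_schedule_disjoint (r := fun i j => pos i < pos j)).
  - by move=> i j k; apply: ltn_trans.
  - by move=> i; rewrite ltnn.
  - by move=> i j; rewrite -neq_ltn (inj_eq val_inj) (inj_eq perm_inj).
move=> j; apply: (order_schedule_completion (r := fun i j => pos i < pos j)
  (d := fun j => rho j)) => [i|i|]; first by rewrite ltnn.
  exact: ord.
by apply: demand0_load => t; exact: feasible_demand.
Qed.

Lemma feasible_le (sigma tau : assignment p) :
  (forall j, sigma j <= tau j) -> feasible sigma -> feasible tau.
Proof.
by move=> le_st [S schedS leS]; exists S => // j; apply: leq_trans (le_st j).
Qed.

(** A schedule may idle and end after T, whereas due dates live in {0, ..., T}. Processing the jobs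
    by completion time without idling brings everything below T and delays no job. *)
Lemma schedule_compress (S : 'I_n -> nat) :
  is_schedule p S ->
  exists2 sigma : assignment p, feasible sigma
    & forall j, sigma j <= completion p S j.
Proof.
move=> schedS; pose S' := due_date_schedule (completion p S).
have leT j : completion p S' j < (horizon p).+1.
  rewrite ltnS /completion /horizon (bigD1 j) //= addnC leq_add2l.
  rewrite /S' /due_date_schedule [X in X <= _]big_mkcond [X in _ <= X]big_mkcond.
  apply: leq_sum => i _; case: eqP => [->|_]; first by rewrite due_date_lt_irr.
  by case: ifP.
exists [ffun j => Ordinal (leT j)].
  exists S'; first exact: due_date_schedule_disjoint.
  by move=> j; rewrite ffunE.
move=> j; rewrite ffunE /=; apply: due_date_schedule_completion.
exact: (schedule_load schedS).
Qed.

End Feasibility.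

(** * The recursion: steps, termination, minimality of the result, cost *)

Section LocalRatio.

Variables (n : nat) (p : 'I_n -> nat).
Hypothesis p_gt0 : forall j, 0 < p j.
Variable R : realFieldType.

Implicit Types (sigma rho tau : assignment p) (g : costs p R) (t s : time p).

Lemma feasible_setT : feasible ([ffun=> ord_max] : assignment p).
Proof.
apply/feasibleP/forallP => t; apply/implyP => t0; rewrite /demand.
under eq_bigl => j do rewrite ffunE /= -ltnS ltn_ord.
by have := ltn_ord t; rewrite -/(horizon p); lia.
Qed.

Lemma demand_gt0_infeasible sigma t :
  0 < t -> 0 < demand t sigma -> ~ feasible sigma.
Proof. by move=> t0 dt /feasible_demand/(_ t0) d0; rewrite d0 in dt. Qed.

Lemma argmax_demand_gt0 sigma t :
  ~ feasible sigma -> is_argmax_demand sigma t -> 0 < demand t sigma.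
Proof.
move=> /infeasible_demand[u u0 du] [_ /(_ u u0)]; exact: leq_trans.
Qed.

Lemma trunc_p_gt0 sigma t j : 0 < demand t sigma -> 0 < trunc_p j t sigma.
Proof. by rewrite /trunc_p leq_min p_gt0 => ->. Qed.

Lemma ghat_gt0 sigma t j s :
  (0 < ghat R sigma t j s)%R -> (sigma j < t) && (t <= s).
Proof. by rewrite /ghat; case: ifP => // _; rewrite ltxx. Qed.

(** The largest admissible multiplier is the least ratio of [g] to [ghat] over the support of
    [ghat], and the residual vanishes at a minimizer. This serves both the existence of a step and
    the correctness of the program. *)
Lemma lr_step_min sigma g t j s :
  nonneg_costs g -> is_argmax_demand sigma t -> 0 < demand t sigma ->
  sigma j < t -> t <= s ->
  (forall i (u : time p), sigma i < t -> t <= u ->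
     (g j s / (trunc_p j t sigma)%:R <= g i u / (trunc_p i t sigma)%:R)%R) ->
  lr_step sigma g j s
    (residual g (ghat R sigma t) (g j s / (trunc_p j t sigma)%:R)%R).
Proof.
move=> g0 amax dt jt ts minjs.
have q0 i : (0 < (trunc_p i t sigma)%:R :> R)%R by rewrite ltr0n trunc_p_gt0.
have E : ghat R sigma t j s = ((trunc_p j t sigma)%:R)%R by rewrite /ghat jt ts.
have res0 : residual g (ghat R sigma t) (g j s / (trunc_p j t sigma)%:R)%R j s
    = 0%R.
  by rewrite /residual E divfK ?subrr // gt_eqF.
split; first by apply: demand_gt0_infeasible dt; case: amax.
exists t, (g j s / (trunc_p j t sigma)%:R)%R; split=> //; last by rewrite E.
split=> [i u|beta /(_ j s)]; rewrite /residual /=; last first.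
  by rewrite E subr_ge0 ler_pdivlMr.
rewrite /ghat; case: ifP => [/andP[it tu]|_]; last by rewrite mulr0 subr0.
by rewrite subr_ge0 -ler_pdivlMr //; apply: minjs.
Qed.

Lemma exists_argmax_demand sigma :
  ~ feasible sigma -> exists t, is_argmax_demand sigma t.
Proof.
move=> /infeasible_demand[u u0 du].
case: (@arg_maxnP _ u (fun t : time p => 0 < t) (fun t => demand t sigma) u0).
by move=> t t0 tmax; exists t; split.
Qed.

Lemma demand_gt0_job sigma t :
  0 < demand t sigma -> 0 < t -> exists j, sigma j < t.
Proof.
move=> dt t0; apply/existsP; rewrite -[X in is_true X]negbK negb_exists.
apply/forallP => nolt; move: dt; rewrite /demand.
rewrite (eq_bigl xpredT) => [|j]; last by rewrite leqNgt nolt.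
by have := ltn_ord t; rewrite -/(horizon p); lia.
Qed.

Lemma exists_lr_step sigma g :
  nonneg_costs g -> ~ feasible sigma -> exists j s g', lr_step sigma g j s g'.
Proof.
move=> g0 infeas; have [t amax] := exists_argmax_demand infeas.
have dt := argmax_demand_gt0 infeas amax.
have [j jt] := demand_gt0_job dt amax.1.
pose elig (x : 'I_n * time p) := (sigma x.1 < t) && (t <= x.2).
pose ratio (x : 'I_n * time p) : R := (g x.1 x.2 / (trunc_p x.1 t sigma)%:R)%R.
(* [ord_max] is T, which is at least [t], so there is a pair to minimize over. *)
have elig0 : elig (j, ord_max) by rewrite /elig /= jt -ltnS ltn_ord.
case: (arg_minP ratio elig0) => -[i s] /andP[it ts] mins.
exists i, s; eexists; apply: (lr_step_min g0 amax dt it ts) => k u kt tu.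
by apply: (mins (k, u)); rewrite /elig kt tu.
Qed.

Lemma lr_step_increases sigma g j s g' : lr_step sigma g j s g' -> sigma j < s.
Proof. by case=> _ [t [a [_ _ _ _ /ghat_gt0/andP[]]]]; exact: leq_trans. Qed.

Lemma lr_step_nonneg sigma g j s g' :
  lr_step sigma g j s g' -> nonneg_costs g'.
Proof. by case=> _ [t [a [_ [g0 _] E _ _]]] i u; rewrite E. Qed.

(** The termination measure: each step raises one due date, hence lowers it. *)
Definition slack sigma := \sum_j (horizon p - sigma j).

Lemma slack_update sigma j s :
  sigma j < s -> slack (update sigma j s) < slack sigma.
Proof.
move=> js; rewrite /slack (bigD1 j) //= [X in _ < X](bigD1 j) //= ffunE eqxx.
rewrite (eq_bigr (fun i => horizon p - sigma i)) => [|i ij]; last first.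
  by rewrite ffunE (negPf ij).
by rewrite ltn_add2r; have := ltn_ord s; lia.
Qed.

Lemma slack_le sigma : slack sigma <= n * horizon p.
Proof.
apply: (@leq_trans (\sum_(j < n) horizon p)).
  by apply: leq_sum => i _; exact: leq_subr.
by rewrite sum_nat_const card_ord.
Qed.

Lemma halts_within_slack k sigma g :
  nonneg_costs g -> slack sigma < k -> halts_within k sigma g.
Proof.
elim: k sigma g => // k IHk sigma g g0 lek /=.
have [feas|infeas] := feasibleP sigma; [by left|right].
split=> [|j s g' st]; first exact: exists_lr_step.
apply: IHk; first exact: lr_step_nonneg st.
exact: leq_trans (slack_update (lr_step_increases st)) _.
Qed.

Lemma feasible_update_le sigma rho i s :
  (forall j, sigma j <= rho j) -> feasible (update sigma i s) ->
  feasible (update rho i s).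
Proof. by move=> le_sr; apply: feasible_le => j; rewrite !ffunE; case: eqP. Qed.

(** Minimality is relative to the due dates on entry of the call. For the chosen job it is the
    outcome of the restoring test. For the other jobs it is inherited from the recursive call, where
    their entry due dates are the same. *)
Lemma local_ratio_minimal sigma g rho :
  local_ratio sigma g rho ->
  [/\ feasible rho, forall i, sigma i <= rho i
    & forall i, sigma i < rho i -> ~ feasible (update rho i (sigma i))].
Proof.
elim=> {sigma g rho} [sigma g feas|sigma g j s g' rho st _ [feas le_r min_r] fr
                     |sigma g j s g' rho st _ [feas le_r min_r] nfr].
- by split=> // i; rewrite ltnn.
- have js := lr_step_increases st.
  have le_s i : sigma i <= rho i.
    by have := le_r i; rewrite ffunE; case: eqP => // ->; lia.
  split=> // i; first by rewrite ffunE; case: eqP => // ->.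
  rewrite {1}ffunE; case: (eqVneq i j) => [->|ij]; first by rewrite ltnn.
  have := min_r i; rewrite {1 2}ffunE (negPf ij) => min_i /min_i nf.
  (* Restoring [j] only lowers due dates, so it cannot make another restoration feasible. *)
  apply: contra_not nf; apply: feasible_update_le => k.
  by rewrite ffunE; case: eqP => // ->.
- have js := lr_step_increases st.
  split=> // [i|i].
    by have := le_r i; rewrite ffunE; case: eqP => // ->; lia.
  case: (eqVneq i j) => [->//|ij].
  by have := min_r i; rewrite {1 2}ffunE (negPf ij).
Qed.

(** * The returned assignment pays at most four times the maximal demand *)

Section KeyBound.

Variables (sigma rho : assignment p) (t : time p).
Hypothesis argmax_t : is_argmax_demand sigma t.
Hypothesis feasible_rho : feasible rho.
Hypothesis sigma_le_rho : forall i, sigma i <= rho i.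
Hypothesis rho_min :
  forall i, sigma i < rho i -> ~ feasible (update rho i (sigma i)).

(** Resetting [i] creates a positive demand at some [u] where [rho] has none, so [i] is what covers
    [u]. The jobs already due at [u] or later under [sigma] are accounted for in [demand u sigma];
    the others raised across [u] must then stay strictly below it. *)
Lemma minimal_witness i : sigma i < rho i ->
  exists u : time p, [/\ sigma i < u, u <= rho i
    & \sum_(j | (sigma j < u <= rho j) && (j != i)) p j < demand t sigma].
Proof.
move=> lti; have [u u0 du] := infeasible_demand (rho_min lti).
have d0 := feasible_demand feasible_rho u0.
have split_i : \sum_(j | u <= update rho i (sigma i) j) p j =
    (if u <= sigma i then p i else 0) + \sum_(j | (u <= rho j) && (j != i)) p j.
  rewrite big_mkcond (bigD1 i) //= ffunE eqxx; congr (_ + _).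
  rewrite -big_mkcondr /=; apply: eq_bigl => j; rewrite ffunE.
  by case: (j == i); rewrite ?andbF //= andbT.
have split_r : \sum_(j | u <= rho j) p j =
    (if u <= rho i then p i else 0) + \sum_(j | (u <= rho j) && (j != i)) p j.
  rewrite big_mkcond (bigD1 i) //= -big_mkcondr /=; congr (_ + _).
  by apply: eq_bigl => j; rewrite andbC.
have [iu ui] : sigma i < u /\ u <= rho i.
  move: du d0 (sigma_le_rho i); rewrite /demand split_i split_r.
  by case: (leqP u (sigma i)); case: (leqP u (rho i)) => //; lia.
(* Maximality of the demand at [t] lets [demand u sigma] stand in for the bound. *)
exists u; split=> //; apply: leq_trans (argmax_t.2 u u0).
have split_s : \sum_(j | (u <= rho j) && (j != i)) p j =
    \sum_(j | u <= sigma j) p j +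
    \sum_(j | (sigma j < u <= rho j) && (j != i)) p j.
  rewrite (bigID (fun j => u <= sigma j)) /=; congr (_ + _); apply: eq_bigl => j.
    case: (leqP u (sigma j)) => uj; rewrite ?andbF // andbT.
    rewrite (leq_trans uj (sigma_le_rho j)) /=.
    by apply: contraTneq uj => ->; rewrite -ltnNge.
  by rewrite -ltnNge andbC -andbA.
move: du; rewrite /demand split_i [u <= sigma i]leqNgt iu /= split_s.
by rewrite add0n subnDA subn_gt0.
Qed.

(** One demand pays for [i], thanks to the truncation, and one for all other jobs of [A], taken with
    their full sizes. *)
Lemma trunc_sum_le (A : pred 'I_n) (i : 'I_n) (u : time p) :
  \sum_(j | (sigma j < u <= rho j) && (j != i)) p j < demand t sigma ->
  (forall j, A j -> sigma j < u <= rho j) ->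
  \sum_(j | A j) trunc_p j t sigma <= 2 * demand t sigma.
Proof.
move=> lt_d subA; have le_i : trunc_p i t sigma <= demand t sigma.
  exact: geq_minr.
suff : \sum_(j | A j) trunc_p j t sigma <=
    trunc_p i t sigma + \sum_(j | (sigma j < u <= rho j) && (j != i)) p j by lia.
rewrite big_mkcond (bigD1 i) //=; apply: leq_add; first by case: ifP.
rewrite -big_mkcondr /= [X in X <= _]big_mkcond [X in _ <= X]big_mkcond.
apply: leq_sum => j _; case: ifP => // /andP[ji /subA ->].
by rewrite ji; exact: geq_minl.
Qed.

(* Each critical job [i] has a critical time [tau i] in [(sigma i, rho i]] at
   which [rho] covers the demand only thanks to [i].  Among the jobs with
   [tau i < t] the interval of every job contains the latest critical time, and
   among the others it contains the earliest one. *)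
Lemma trunc_sum_critical :
  \sum_(j | sigma j < t <= rho j) trunc_p j t sigma <= 4 * demand t sigma.
Proof.
pose good i (u : time p) := [&& sigma i < u, u <= rho i
  & \sum_(j | (sigma j < u <= rho j) && (j != i)) p j < demand t sigma].
(* The default [ord0] is never taken for a job with [sigma i < t <= rho i], by [minimal_witness]. *)
pose tau i := odflt ord0 [pick u | good i u].
have tauP i : sigma i < t <= rho i -> good i (tau i).
  case/andP=> it ti; rewrite /tau; case: pickP => //= nou.
  have [u [u1 u2 u3]] := minimal_witness (leq_trans it ti).
  by have := nou u; rewrite /good u1 u2 u3.
rewrite (bigID (fun j => tau j < t)) /= (mulnDl 2 2).
apply: leq_add.
  pose A (j : 'I_n) := (sigma j < t <= rho j) && (tau j < t).
  case: (pickP A) => [i0 Ai0|noA]; last by rewrite big_pred0.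
  case: (@arg_maxnP _ i0 A (fun j => tau j) Ai0) => i /andP[Bi it] maxi.
  have /and3P[_ _ sum_i] := tauP i Bi.
  apply: (trunc_sum_le (A := A) sum_i) => j Aj; have := maxi j Aj.
  by case/andP: Aj => Bj jt; have /and3P[? ? _] := tauP j Bj; lia.
pose A (j : 'I_n) := (sigma j < t <= rho j) && ~~ (tau j < t).
case: (pickP A) => [i0 Ai0|noA]; last by rewrite big_pred0.
case: (@arg_minnP _ i0 A (fun j => tau j) Ai0) => i /andP[Bi it] mini.
have /and3P[_ _ sum_i] := tauP i Bi.
apply: (trunc_sum_le (A := A) sum_i) => j Aj; have := mini j Aj.
by case/andP: Aj => Bj jt; have /and3P[? ? _] := tauP j Bj; lia.
Qed.

End KeyBound.

(* The knapsack-cover inequality. *)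
Lemma demand_le_trunc_sum sigma tau t :
  feasible tau -> 0 < t ->
  demand t sigma <= \sum_(j | sigma j < t <= tau j) trunc_p j t sigma.
Proof.
move=> feas t0; have d0 := feasible_demand feas t0.
(* Either a single job is truncated and pays the whole demand by itself, or no size is truncated and
   the plain covering inequality applies. *)
case: (boolP [exists j, (sigma j < t <= tau j) && (demand t sigma <= p j)]).
  case/existsP=> j /andP[jt dp]; rewrite (bigD1 j) //=.
  by rewrite /trunc_p (minn_idPr dp) leq_addr.
rewrite negb_exists => /forallP small.
rewrite (eq_bigr p) => [|j jt]; last first.
  by have := small j; rewrite jt /= -ltnNge => /ltnW; exact: minn_idPl.
suff : \sum_(j | t <= tau j) p j <= \sum_(j | t <= sigma j) p j +
    \sum_(j | sigma j < t <= tau j) p j.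
  move=> le_cover; rewrite leq_subLR; apply: leq_trans le_cover.
  by rewrite -subn_eq0; apply/eqP.
rewrite (bigID (fun j => t <= sigma j)) /=; apply: leq_add.
  rewrite big_mkcond [X in _ <= X]big_mkcond; apply: leq_sum => j _.
  by case: (t <= sigma j); rewrite ?andbF //= andbT; case: ifP.
by apply: eq_leq; apply: eq_bigl => j; rewrite -ltnNge andbC.
Qed.

Lemma sum_ghat sigma rho t :
  (\sum_j ghat R sigma t j (rho j) =
   (\sum_(j | sigma j < t <= rho j) trunc_p j t sigma)%N%:R)%R.
Proof. by rewrite natr_sum [RHS]big_mkcond. Qed.

(** [ghat] vanishes at the current due dates, so their cost stays zero, and the new due date is
    chosen where the residual is zero. Hence the recursive call again starts at cost zero, and
    resetting [j] to [sigma j] is free under [g']. *)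
Lemma lr_step_zero sigma g j s g' :
  lr_step sigma g j s g' -> (forall i, g i (sigma i) = 0%R) ->
  [/\ forall i, g' i (sigma i) = 0%R, nonneg_costs g'
    & forall i, g' i (update sigma j s i) = 0%R].
Proof.
move=> st gs0; have g's i : g' i (sigma i) = 0%R.
  case: st => _ [t [a [_ _ g'E _ _]]].
  by rewrite g'E /residual gs0 /ghat (leqNgt t) andbN mulr0 subrr.
split=> // [|i]; first exact: lr_step_nonneg st.
rewrite ffunE; case: eqP => [->|//].
by case: st => _ [t [a []]].
Qed.

(** The local-ratio argument: [g] splits as [g'] plus a multiple of [ghat], and a ratio of 4 on both
    parts gives it for the sum. On [ghat], [rho] pays at most four demands and [tau] at least
    one. *)
Lemma lr_step_cost sigma g j s g' rho (tau : assignment p) :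
  lr_step sigma g j s g' -> local_ratio sigma g rho -> feasible tau ->
  nonneg_costs g ->
  (\sum_j g' j (rho j) <= 4 * \sum_j g' j (tau j))%R ->
  (\sum_j g j (rho j) <= 4 * \sum_j g j (tau j))%R.
Proof.
move=> [_ [t [a [amax amult g'E _ _]]]] lr feas g0 le_g'.
(* The multiplier 0 is admissible because [g] is nonnegative. *)
have a_ge0 : (0 <= a)%R.
  by apply: amult.2 => i u; rewrite /residual mul0r subr0.
have gE (sg : assignment p) : (\sum_j g j (sg j) =
    \sum_j g' j (sg j) + a * \sum_j ghat R sigma t j (sg j))%R.
  rewrite mulr_sumr -big_split /=; apply: eq_bigr => i _.
  by rewrite g'E /residual subrK.
rewrite !gE mulrDr; apply: lerD => //; rewrite mulrCA; apply: ler_wpM2l => //.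
rewrite !sum_ghat -natrM ler_nat.
have [feas_r le_r min_r] := local_ratio_minimal lr.
apply: leq_trans (trunc_sum_critical amax feas_r le_r min_r) _.
by rewrite leq_mul2l demand_le_trunc_sum //; case: amax.
Qed.

Lemma local_ratio_cost sigma g rho (tau : assignment p) :
  local_ratio sigma g rho -> feasible tau -> nonneg_costs g ->
  (forall j, g j (sigma j) = 0%R) ->
  (\sum_j g j (rho j) <= 4 * \sum_j g j (tau j))%R.
Proof.
move=> lr feas_tau; elim: lr => {sigma g rho} [sigma g _ g0 gs0||].
- by rewrite big1 // mulr_ge0 // sumr_ge0.
- move=> sigma g j s g' rho st lr IH fr g0 gs0.
  apply: (lr_step_cost st (LR_restore st lr fr)) => //.
  have [g's g'ge0 gs'0] := lr_step_zero st gs0.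
  (* The induction hypothesis bounds the unrestored result; restoring [j] replaces its cost under
     [g'] by zero. *)
  apply: le_trans (IH g'ge0 gs'0); apply: ler_sum => i _; rewrite ffunE.
  by case: eqP => // ->; rewrite g's g'ge0.
- move=> sigma g j s g' rho st lr IH nfr g0 gs0.
  apply: (lr_step_cost st (LR_keep st lr nfr)) => //.
  have [g's g'ge0 gs'0] := lr_step_zero st gs0.
  exact: IH.
Qed.

End LocalRatio.

(** * Comparison with the optimal cost *)

Section Approximation.

Variables (n : nat) (p : 'I_n -> nat) (f : 'I_n -> nat -> nat).
Hypothesis valid : valid_instance p f.

Lemma sched_cost_meets (S : 'I_n -> nat) (sigma : assignment p) :
  meets S sigma -> sched_cost p f S <= \sum_j f j (sigma j).
Proof. by case: valid => _ f_mono _ leS; apply: leq_sum => j _; apply: f_mono. Qed.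

(** Feasible assignments form a finite nonempty set, so a cheapest one exists. It is a lower bound
    for every schedule by [schedule_compress], and a schedule meeting it attains the bound. *)
Lemma exists_optimal_assignment :
  exists2 tau : assignment p, feasible tau
    & optimal_cost p f (\sum_j f j (tau j)).
Proof.
pose cost (sigma : assignment p) := \sum_j f j (sigma j).
have /feasibleP feasT := feasible_setT p.
case: (@arg_minnP _ _ (@feasibleb n p) cost feasT) => tau /feasibleP feas min_tau.
have lb S : is_schedule p S -> cost tau <= sched_cost p f S.
  move=> /schedule_compress[sigma /feasibleP/min_tau le_ts leS].
  apply: leq_trans le_ts _; case: valid => _ f_mono _.
  by apply: leq_sum => j _; apply: f_mono.
exists tau => //; split=> //; case: feas => S schedS leS; exists S => //.
by apply/eqP; rewrite eqn_leq lb // sched_cost_meets.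
Qed.

Lemma local_ratio_4_approx (R : realFieldType) (rho tau : assignment p) :
  local_ratio (sigma_init p) (costs_init R f) rho -> feasible tau ->
  \sum_j f j (rho j) <= 4 * \sum_j f j (tau j).
Proof.
case: valid => p_gt0 f_mono f0 lr feas.
have := local_ratio_cost lr feas.
rewrite -(ler_nat R) natrM !natr_sum; apply=> [i t|j]; first exact: ler0n.
by rewrite /costs_init ffunE f0.
Qed.

End Approximation.

(** * A logic for the machine *)

(** Modification is tracked per array, not per cell; this syntactic overapproximation is enough for
    framing. *)
Fixpoint nwrites (c : cmd) : seq nat :=
  match c with
  | NSet a _ _ _ => [:: a]
  | Seq c1 c2 => nwrites c1 ++ nwrites c2
  | If _ c1 c2 => nwrites c1 ++ nwrites c2
  | While _ c1 => nwrites c1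
  | _ => [::]
  end.

Fixpoint rwrites (c : cmd) : seq nat :=
  match c with
  | RSet a _ _ _ => [:: a]
  | Seq c1 c2 => rwrites c1 ++ rwrites c2
  | If _ c1 c2 => rwrites c1 ++ rwrites c2
  | While _ c1 => rwrites c1
  | _ => [::]
  end.

(* A bound on the number of steps if every execution of a loop in [c] makes at
   most [M] iterations. *)
Fixpoint cost (M : nat) (c : cmd) : nat :=
  match c with
  | Seq c1 c2 => cost M c1 + cost M c2
  | If _ c1 c2 => (cost M c1 + cost M c2).+1
  | While _ c1 => (M * (cost M c1).+1).+1
  | _ => 1
  end.

(** The degree depends on the program only. Exponents of subcommands are added, which is harmless as
    [M] is at least 1. *)
Lemma cost_poly c : exists a k, forall M, 0 < M -> cost M c <= a * M ^ k.
Proof.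
have pow k l M : 0 < M -> M ^ k <= M ^ (k + l).
  by move=> M0; rewrite leq_pexp2l // leq_addr.
elim: c => [|a e1 e2 e|a e1 e2 e|c1 [a1 [k1 H1]] c2 [a2 [k2 H2]]
           |b c1 [a1 [k1 H1]] c2 [a2 [k2 H2]]|b c1 [a1 [k1 H1]]] /=.
1-3: by exists 1, 0.
- exists (a1 + a2), (k1 + k2) => M M0; rewrite mulnDl; apply: leq_add.
    by apply: leq_trans (H1 M M0) _; rewrite leq_mul2l pow ?orbT.
  by apply: leq_trans (H2 M M0) _; rewrite leq_mul2l addnC pow ?orbT.
- exists (a1 + a2).+1, (k1 + k2) => M M0; rewrite -add1n -[in X in _ <= X]add1n.
  rewrite !mulnDl mul1n; apply: leq_add; first by rewrite expn_gt0 M0.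
  apply: leq_add.
    by apply: leq_trans (H1 M M0) _; rewrite leq_mul2l pow ?orbT.
  by apply: leq_trans (H2 M M0) _; rewrite leq_mul2l addnC pow ?orbT.
(* Of the two extra units, one pays for the test in each iteration and one for the final failing
   test. *)
- exists a1.+2, k1.+1 => M M0; have := H1 M M0.
  have : 0 < M ^ k1 by rewrite expn_gt0 M0.
  rewrite expnS; move: (M ^ k1) => X X0 leX; rewrite mulnCA -add1n.
  have : (cost M c1).+1 <= a1.+1 * X by lia.
  move/(leq_mul (leqnn M)) => le1; apply: (leq_trans (leq_add (leqnn 1) le1)).
  rewrite [a1.+2 * X]mulSn mulnDr leq_add2r; nia.
Qed.

Section MachineLogic.

Variables (R : realFieldType) (M : nat).
Implicit Types (m : memory R) (c : cmd) (Q : memory R -> Prop).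

Definition same (ln lr : seq nat) m m' : Prop :=
  (forall a i j, a \notin ln -> nmem m' a i j = nmem m a i j) /\
  (forall a i j, a \notin lr -> rmem m' a i j = rmem m a i j).

Lemma same_trans ln lr m1 m2 m3 :
  same ln lr m1 m2 -> same ln lr m2 m3 -> same ln lr m1 m3.
Proof.
move=> [n12 r12] [n23 r23].
by split=> a i j ha; [rewrite n23 ?n12 | rewrite r23 ?r12].
Qed.

Lemma same_sub ln lr ln' lr' m m' :
  {subset ln <= ln'} -> {subset lr <= lr'} -> same ln lr m m' ->
  same ln' lr' m m'.
Proof.
move=> sn sr [nE rE].
by split=> a i j ha; [rewrite nE //|rewrite rE //]; apply: contra ha; auto.
Qed.

Lemma exec_same c m m' k : exec c m m' k -> same (nwrites c) (rwrites c) m m'.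
Proof.
elim=> {c m m' k} //=.
- move=> m a e1 e2 e; split=> //= a' i j; rewrite inE => /negPf aa.
  by rewrite /write aa.
- move=> m a e1 e2 e; split=> //= a' i j; rewrite inE => /negPf aa.
  by rewrite /write aa.
- move=> c1 c2 m m1 m2 k1 k2 _ s1 _ s2; apply: same_trans; [move: s1|move: s2];
    by apply: same_sub => x; rewrite mem_cat => ->; rewrite ?orbT.
- by move=> b c1 c2 m m' k _ _; apply: same_sub => x; rewrite mem_cat => ->.
- move=> b c1 c2 m m' k _ _; apply: same_sub => x; rewrite mem_cat => ->;
    exact: orbT.
- by move=> b c m m1 m2 k1 k2 _ _ s1 _ s2; apply: same_trans s1 s2.
Qed.

(** A total-correctness triple with the time bound built in, so that specifications never mention
    step counts. *)
Definition run c m Q : Prop :=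
  exists m' k, [/\ exec c m m' k, k <= cost M c & Q m'].

(** The rules of consequence and of framing in one: postconditions need only state what changes. *)
Lemma run_frame c m Q Q' :
  run c m Q -> (forall m', same (nwrites c) (rwrites c) m m' -> Q m' -> Q' m') ->
  run c m Q'.
Proof.
move=> [m' [k [ex lek Qm']]] QQ'; exists m', k; split=> //.
exact: QQ' (exec_same ex) Qm'.
Qed.

Lemma run_skip m Q : Q m -> run Skip m Q.
Proof. by exists m, 1; split=> //; constructor. Qed.

Lemma run_nset a e1 e2 e m Q :
  Q (Memory (write (nmem m) a (neval m e1) (neval m e2) (neval m e)) (rmem m)) ->
  run (NSet a e1 e2 e) m Q.
Proof. by move=> Qm; eexists; exists 1; split=> //; [constructor|]. Qed.

Lemma run_rset a e1 e2 e m Q :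
  Q (Memory (nmem m) (write (rmem m) a (neval m e1) (neval m e2) (reval m e))) ->
  run (RSet a e1 e2 e) m Q.
Proof. by move=> Qm; eexists; exists 1; split=> //; [constructor|]. Qed.

Lemma run_seq c1 c2 m Q :
  run c1 m (fun m' => run c2 m' Q) -> run (Seq c1 c2) m Q.
Proof.
move=> [m1 [k1 [ex1 le1 [m2 [k2 [ex2 le2 Qm2]]]]]].
by exists m2, (k1 + k2); split=> //=; [apply: ExecSeq ex1 ex2|exact: leq_add].
Qed.

Lemma run_if b c1 c2 m Q :
  (teval m b -> run c1 m Q) -> (~~ teval m b -> run c2 m Q) ->
  run (If b c1 c2) m Q.
Proof.
case: (boolP (teval m b)) => bm.
  move=> /(_ isT)[m' [k [ex lek Qm']]] _; exists m', k.+1.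
  by split=> //=; [apply: ExecIfT|rewrite ltnS; apply: leq_trans (leq_addr _ _)].
move=> _ /(_ isT)[m' [k [ex lek Qm']]]; exists m', k.+1.
by split=> //=; [apply: ExecIfF|rewrite ltnS; apply: leq_trans (leq_addl _ _)].
Qed.

(** The index of [I] bounds the iterations still to come, and [k <= M] ties it to [cost]. *)
Lemma run_while (I : nat -> memory R -> Prop) b c k m Q :
  (forall k m, I k m -> teval m b -> 0 < k /\ run c m (I k.-1)) ->
  (forall k m, I k m -> ~~ teval m b -> Q m) ->
  k <= M -> I k m -> run (While b c) m Q.
Proof.
move=> step exit_ leM Im.
(* The bound is sharpened from [M] to [k] iterations so that induction on [k] applies. *)
suff [m' [l [ex lel Qm']]] : exists m' l,
    [/\ exec (While b c) m m' l, l <= (k * (cost M c).+1).+1 & Q m'].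
  exists m', l; split=> //=; apply: leq_trans lel _.
  by rewrite ltnS leq_mul2r leM orbT.
elim: k m Im {leM} => [|k IHk] m Im; case: (boolP (teval m b)) => bm.
- by have [] := step _ _ Im bm.
- by exists m, 1; split=> //; [apply: ExecWhileF|exact: exit_ Im bm].
- have [_ [m1 [k1 [ex1 le1 Im1]]]] := step _ _ Im bm.
  have [m2 [k2 [ex2 le2 Qm2]]] := IHk _ Im1.
  exists m2, (k1 + k2).+1; split=> //; first exact: ExecWhileT ex1 ex2.
  by rewrite mulSn; lia.
- by exists m, 1; split=> //; [apply: ExecWhileF|exact: exit_ Im bm].
Qed.

Definition At (a : nat) (e : nexp) : nexp := NGet a e (NLit 0).
Definition Get (a : nat) : nexp := At a (NLit 0).
Definition Put (a : nat) (e : nexp) : cmd := NSet a (NLit 0) (NLit 0) e.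
Definition Succ (e : nexp) : nexp := NAdd e (NLit 1).

Definition put m (a v : nat) : memory R :=
  Memory (write (nmem m) a 0 0 v) (rmem m).

Lemma nmem_put m a v : nmem (put m a v) a 0 0 = v.
Proof. by rewrite /= /write !eqxx. Qed.

Lemma same_put m a v ln lr : a \in ln -> same ln lr m (put m a v).
Proof.
move=> aln; split=> //= a' i j ha'; rewrite /write; case: eqP => //= aa.
by rewrite aa aln in ha'.
Qed.

Definition For (x : nat) (e : nexp) (c : cmd) : cmd :=
  Seq (Put x (NLit 0))
      (While (NLe (Succ (Get x)) e) (Seq c (Put x (Succ (Get x))))).

(** The bound [e] is evaluated anew at each test, hence the demand that it be stable. [I] must
    ignore the counter cell, which is overwritten between two iterations. *)
Lemma run_for (I : nat -> memory R -> Prop) (N : nat) x e c m :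
  x \notin nwrites c -> N <= M ->
  (forall m', same (x :: nwrites c) (rwrites c) m m' -> neval m' e = N) ->
  (forall i m' v, I i m' -> I i (put m' x v)) ->
  I 0 m ->
  (forall i m', i < N -> same (x :: nwrites c) (rwrites c) m m' ->
     nmem m' x 0 0 = i -> I i m' -> run c m' (I i.+1)) ->
  run (For x e c) m (I N).
Proof.
move=> xc leN eN Ix I0 step; apply/run_seq/run_nset.
pose J k m' := [/\ same (x :: nwrites c) (rwrites c) m m', k <= N,
  nmem m' x 0 0 = N - k & I (N - k) m'].
apply: (run_while (I := J) (k := N)) => //; last first.
- split=> //; rewrite ?subnn; [|exact: nmem_put|exact: Ix].
  by apply: same_put; rewrite mem_head.
- move=> k m' [sm lek xm Im]; rewrite /= eN // xm => Nk.
  by rewrite (_ : N = N - k) //; lia.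
move=> k m' [sm lek xm Im]; rewrite /= eN // xm => Nk.
have k0 : 0 < k by lia.
split=> //; apply: run_seq; have ltN : N - k < N by lia.
apply: (run_frame (step _ _ ltN sm xm Im)) => m1 sm1 Im1.
have E : N - k.-1 = (N - k).+1 by lia.
have xm1 : nmem m1 x 0 0 = N - k by rewrite sm1.1.
apply: run_nset; rewrite /= xm1 addn1; split; rewrite ?E.
- apply: (same_trans sm).
  apply: (@same_trans _ _ _ m1); last by apply: same_put; rewrite mem_head.
  by apply: same_sub sm1 => y // yc; rewrite inE yc orbT.
- lia.
- exact: nmem_put.
- exact: Ix.
Qed.

Definition SumLoop (acc x : nat) (e : nexp) (b : test) (v : nexp) : cmd :=
  Seq (Put acc (NLit 0))
      (For x e (If b (Put acc (NAdd (Get acc) v)) Skip)).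

Lemma run_sum acc x e b v (N : nat) (P : pred nat) (F : nat -> nat) m :
  x != acc -> N <= M ->
  (forall m', same [:: acc; x] [::] m m' -> neval m' e = N) ->
  (forall m' i, i < N -> same [:: acc; x] [::] m m' -> nmem m' x 0 0 = i ->
     teval m' b = P i /\ neval m' v = F i) ->
  run (SumLoop acc x e b v) m
    (fun m' => nmem m' acc 0 0 = \sum_(i < N | P i) F i).
Proof.
move=> xacc leN eN bv; apply/run_seq/run_nset => /=.
have sub : {subset [:: x; acc] <= [:: acc; x]}.
  by move=> y; rewrite !inE orbC.
have s0 m' : same [:: x; acc] [::] (put m acc 0) m' -> same [:: acc; x] [::] m m'.
  by move=> /(same_sub sub (fun _ => id)); apply/same_trans/same_put/mem_head.
apply: (run_for (N := N)
  (I := fun k m' => nmem m' acc 0 0 = \sum_(i < k | P i) F i)) => //=.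
- by rewrite inE.
- by move=> m' /s0; apply: eN.
- by move=> i m' w; rewrite /write eq_sym (negPf xacc).
- by rewrite /write !eqxx big_ord0.
- move=> i m' ltN /s0 sm xm accm; have [bP vF] := bv _ _ ltN sm xm.
  rewrite big_mkcond big_ord_recr -big_mkcond /= -accm.
  apply: run_if; rewrite bP => Pi; [apply: run_nset|apply: run_skip].
    by rewrite /write /= eqxx Pi /= vF.
  by rewrite (negPf Pi) addn0.
Qed.

End MachineLogic.

(** * The program *)

Local Notation jobs := 0 (only parsing).
Local Notation proc := 1 (only parsing).
Local Notation due := 2 (only parsing).
Local Notation start := 3 (only parsing).
Local Notation total := 4 (only parsing).
Local Notation jvar := 5 (only parsing).
Local Notation tvar := 6 (only parsing).
Local Notation acc := 7 (only parsing).
Local Notation best := 8 (only parsing).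
Local Notation tstar := 9 (only parsing).
Local Notation found := 10 (only parsing).
Local Notation bestj := 11 (only parsing).
Local Notation bests := 12 (only parsing).
Local Notation depth := 13 (only parsing).
Local Notation stackj := 14 (only parsing).
Local Notation stackd := 15 (only parsing).
Local Notation saved := 16 (only parsing).
(* [gcell] and [alpha] number arrays of the R memory. *)
Local Notation gcell := 0 (only parsing).
Local Notation alpha := 1 (only parsing).

(** [tvar] holds t - 1, so [total] minus [tvar] is T - t + 1. The final value of [best] also decides
    feasibility: it is 0 exactly when all demands vanish. *)
Definition MaxDemand : cmd :=
  Seq (Put best (NLit 0))
      (For tvar (Get total)
         (Seq (SumLoop acc jvar (Get jobs)
                 (NLe (Succ (Get tvar)) (At due (Get jvar)))
                 (At proc (Get jvar)))
         (Seq (Put acc (NSub (NSub (Get total) (Get tvar)) (Get acc)))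
              (If (NLe (Succ (Get best)) (Get acc))
                  (Seq (Put best (Get acc)) (Put tstar (Succ (Get tvar))))
                  Skip)))).

(* These are the pairs (j, t) with ghat_j(t) > 0. *)
Definition ForEligible (c : cmd) : cmd :=
  For jvar (Get jobs)
    (If (NLe (Succ (At due (Get jvar))) (Get tstar))
        (For tvar (Succ (Get total)) (If (NLe (Get tstar) (Get tvar)) c Skip))
        Skip).

(* min(p, D) = p - (p - D) with truncated subtraction. *)
Definition Trunc : nexp :=
  NSub (At proc (Get jvar)) (NSub (At proc (Get jvar)) (Get best)).

Definition CurG : rexp := RGet gcell (Get jvar) (Get tvar).
Definition Alpha : rexp := RGet alpha (NLit 0) (NLit 0).

Definition Record : cmd :=
  Seq (RSet alpha (NLit 0) (NLit 0) (RDiv CurG Trunc))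
  (Seq (Put bestj (Get jvar))
  (Seq (Put bests (Get tvar)) (Put found (NLit 1)))).

(** The flag [found] replaces an infinite initial value of the minimum. *)
Definition Select : cmd :=
  Seq (Put found (NLit 0))
      (ForEligible
         (If (NLe (Get found) (NLit 0)) Record
             (If (RLe (RDiv CurG Trunc) Alpha) Record Skip))).

Definition Reduce : cmd :=
  ForEligible
    (RSet gcell (Get jvar) (Get tvar) (RSub CurG (RMul Alpha Trunc))).

Definition Push : cmd :=
  Seq (NSet stackj (Get depth) (NLit 0) (Get bestj))
  (Seq (NSet stackd (Get depth) (NLit 0) (At due (Get bestj)))
  (Seq (Put depth (Succ (Get depth)))
       (NSet due (Get bestj) (NLit 0) (Get bests)))).

(** The loop test reads the result of the latest [MaxDemand], which therefore runs once before the
    loop and at the end of each iteration. *)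
Definition Descend : cmd :=
  While (NLe (NLit 1) (Get best)) (Seq Select (Seq Reduce (Seq Push MaxDemand))).

Definition Unwind : cmd :=
  While (NLe (NLit 1) (Get depth))
    (Seq (Put depth (NSub (Get depth) (NLit 1)))
    (Seq (Put saved (At due (At stackj (Get depth))))
    (Seq (NSet due (At stackj (Get depth)) (NLit 0) (At stackd (Get depth)))
    (Seq MaxDemand
         (If (NLe (NLit 1) (Get best))
             (NSet due (At stackj (Get depth)) (NLit 0) (Get saved))
             Skip))))).

Definition Horizon : cmd :=
  SumLoop total jvar (Get jobs) (NLe (NLit 0) (NLit 0)) (At proc (Get jvar)).

(* The test is [due_date_lt]: 1 - (t - j) is 1 if t <= j and 0 otherwise. *)
Definition Schedule : cmd :=
  For tvar (Get jobs)
    (Seq (SumLoop acc jvar (Get jobs)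
            (NLe (NAdd (At due (Get jvar))
                       (NSub (NLit 1) (NSub (Get tvar) (Get jvar))))
                 (At due (Get tvar)))
            (At proc (Get jvar)))
         (NSet start (Get tvar) (NLit 0) (Get acc))).

Definition LocalRatio : cmd :=
  Seq Horizon (Seq MaxDemand (Seq Descend (Seq Unwind Schedule))).

(** * Correctness of the program pieces *)

Section Program.

Variables (n : nat) (p : 'I_n -> nat) (R : realFieldType) (M : nat).
Hypothesis p_gt0 : forall j, 0 < p j.
Hypothesis n_leM : n <= M.
Hypothesis T_ltM : horizon p < M.
Implicit Types (m : memory R) (sigma rho : assignment p) (g : costs p R).

Definition holds_instance m : Prop :=
  [/\ nmem m jobs 0 0 = n, nmem m total 0 0 = horizon p
    & forall j : 'I_n, nmem m proc j 0 = p j].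

Definition holds_due m sigma : Prop := forall j : 'I_n, nmem m due j 0 = sigma j.

Definition holds_costs m g : Prop :=
  forall (j : 'I_n) (t : time p), rmem m gcell j t = g j t.

Lemma holds_instance_same ln lr m m' :
  all (fun a => a \notin ln) [:: jobs; proc; total] -> same ln lr m m' ->
  holds_instance m -> holds_instance m'.
Proof.
move=> /and4P[l0 l1 l4 _] [nE _] [m0 m4 m1].
by split=> [||j]; rewrite nE.
Qed.

Lemma holds_due_same ln lr m m' sigma :
  due \notin ln -> same ln lr m m' -> holds_due m sigma -> holds_due m' sigma.
Proof. by move=> l2 [nE _] m2 j; rewrite nE. Qed.

Lemma holds_costs_same ln lr m m' g :
  gcell \notin lr -> same ln lr m m' -> holds_costs m g -> holds_costs m' g.
Proof. by move=> l0 [_ rE] m0 j t; rewrite rE. Qed.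

Definition max_demand_spec sigma m : Prop :=
  (nmem m best 0 0 = 0 -> feasible sigma) /\
  (0 < nmem m best 0 0 -> exists t : time p,
     [/\ nmem m tstar 0 0 = t, is_argmax_demand sigma t
       & demand t sigma = nmem m best 0 0]).

Lemma run_max_demand m sigma :
  holds_instance m -> holds_due m sigma ->
  run M MaxDemand m (max_demand_spec sigma).
Proof.
move=> inst hdue; apply/run_seq/run_nset => /=.
set m0 := Memory _ _.
have s0 : same [:: best] [::] m m0 by apply: same_put.
have inst0 : holds_instance m0 by apply: holds_instance_same s0 _.
have hdue0 : holds_due m0 sigma by apply: holds_due_same s0 _.
(* The demand at a natural number, so that the invariant can apply it to the contents of a cell. *)
pose dem u := horizon p - u + 1 - \sum_(j | u <= sigma j) p j.
pose I k m' := (forall u, 0 < u <= k -> dem u <= nmem m' best 0 0) /\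
  (0 < nmem m' best 0 0 -> 0 < nmem m' tstar 0 0 <= k /\
     dem (nmem m' tstar 0 0) = nmem m' best 0 0).
apply: (run_frame (run_for (I := I) (N := horizon p) _ _ _ _ _ _)) => //.
- exact: ltnW.
- by move=> m' sm /=; rewrite sm.1 //; case: inst0.
- by split=> //= u /andP[u0]; rewrite leqNgt u0.
- move=> i m' ltN sm ti [ub wit].
  apply: run_seq.
  have inst' : holds_instance m' by apply: holds_instance_same sm inst0.
  have hdue' : holds_due m' sigma by apply: holds_due_same sm hdue0.
  apply: (run_frame (run_sum (N := n) (P := fun j => i.+1 <= nmem m' due j 0)
     (F := fun j => nmem m' proc j 0) _ _ _ _)) => //.
  + by move=> m1 s1 /=; rewrite s1.1 //; case: inst'.
  + move=> m1 j ltj s1 j1; rewrite /= j1 !s1.1 // ti addn1.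
    by [].
  move=> m1 s1 acc1; apply/run_seq/run_nset => /=.
  have t1 : nmem m1 total 0 0 = horizon p by rewrite s1.1 //; case: inst'.
  have i1 : nmem m1 tvar 0 0 = i by rewrite s1.1.
  have E : nmem m1 total 0 0 - nmem m1 tvar 0 0 - nmem m1 acc 0 0 = dem i.+1.
    rewrite t1 i1 acc1 /dem; congr (_ - _); first by lia.
    rewrite (eq_bigl (fun j : 'I_n => i < sigma j)) => [|j]; last by rewrite hdue'.
    by apply: eq_bigr => j _; case: inst'.
  rewrite E; have b1 : nmem m1 best 0 0 = nmem m' best 0 0 by rewrite s1.1.
  have ts1 : nmem m1 tstar 0 0 = nmem m' tstar 0 0 by rewrite s1.1.
  apply: run_if => /=; rewrite {1}/write /= b1 addn1 /write /= => le_b.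
    apply/run_seq/run_nset/run_nset; rewrite /= /write /= i1 addn1.
    split=> [u /andP[u0]|_]; rewrite /= ?ltnS ?leqnn //.
    rewrite leq_eqVlt => /orP[/eqP->//|]; rewrite ltnS => le_ui.
    by apply: leq_trans (ltnW le_b); apply: ub; rewrite u0.
  apply: run_skip; rewrite /I /= b1 ts1; split=> [u /andP[u0]|b0].
    rewrite leq_eqVlt => /orP[/eqP->|]; first by rewrite leqNgt.
    by rewrite ltnS => le_ui; apply: ub; rewrite u0.
  by have [/andP[-> le_t] ->] := wit b0; rewrite (leqW le_t).
move=> m' sm [ub wit]; split=> [b0|b0].
  apply/feasibleP/forallP => t; apply/implyP => t0; rewrite -leqn0 -b0.
  by apply: ub; rewrite t0 -ltnS ltn_ord.
have [/andP[t0 le_t] dt] := wit b0.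
exists (inord (nmem m' tstar 0 0)); rewrite /demand inordK ?ltnS //; split=> //.
split=> [|t tt]; rewrite /demand inordK ?ltnS //.
by rewrite -!/(dem _) dt; apply: ub; rewrite tt -ltnS ltn_ord.
Qed.

Definition eligible sigma (u : time p) : pred ('I_n * time p) :=
  fun x => (sigma x.1 < u) && (u <= x.2).

(** [J] is indexed by the set of pairs already visited. It depends only on the eligible ones, so
    skipping the others preserves it, and [~~ A x] records that no pair is visited twice. *)
Lemma run_for_eligible (J : pred ('I_n * time p) -> memory R -> Prop) c m sigma
    (u : time p) :
  jvar \notin nwrites c -> tvar \notin nwrites c ->
  all (fun a => a \notin nwrites c) [:: jobs; total; due; tstar] ->
  holds_instance m -> holds_due m sigma -> nmem m tstar 0 0 = u ->
  (forall A B m', (forall x, eligible sigma u x -> A x = B x) -> J A m' -> J B m') ->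
  (forall A m' v, J A m' -> J A (put m' jvar v)) ->
  (forall A m' v, J A m' -> J A (put m' tvar v)) ->
  J pred0 m ->
  (forall A (x : 'I_n * time p) m',
     same (jvar :: tvar :: nwrites c) (rwrites c) m m' ->
     nmem m' jvar 0 0 = x.1 -> nmem m' tvar 0 0 = x.2 -> eligible sigma u x ->
     ~~ A x -> J A m' -> run M c m' (J (predU1 x A))) ->
  run M (ForEligible c) m (J predT).
Proof.
move=> jc tc /and5P[c0 c4 c2 c9 _] [n0 T0 p0] hdue ts Jext Jj Jt J0 step.
pose inner := If (NLe (Get tstar) (Get tvar)) c Skip.
pose outer := If (NLe (Succ (At due (Get jvar))) (Get tstar))
  (For tvar (Succ (Get total)) inner) Skip.
have sub m1 m2 : same (jvar :: nwrites outer) (rwrites outer) m1 m2 ->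
    same (jvar :: tvar :: nwrites c) (rwrites c) m1 m2.
  apply: same_sub => y; rewrite /= ?cats0 //= !inE !mem_cat !inE.
  by case: (y == jvar); case: (y == tvar); rewrite //= ?orbF.
have sub' m1 m2 : same (tvar :: nwrites inner) (rwrites inner) m1 m2 ->
    same (tvar :: nwrites c) (rwrites c) m1 m2.
  by rewrite /= !cats0.
pose I (i : nat) := J (fun x => x.1 < i).
apply: (run_frame (run_for (I := I) (N := n) _ _ _ _ _ _)) => //.
- by rewrite /= ?inE ?mem_cat ?inE ?(negPf jc).
- by move=> m' /sub sm /=; rewrite sm.1 // !inE.
- by move=> i m' v; exact: Jj.
- move=> i m' lti /sub sm ji Ji; pose j := Ordinal lti.
  have ts' : nmem m' tstar 0 0 = u by rewrite sm.1 // !inE.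
  have due' : nmem m' due i 0 = sigma j by rewrite sm.1 ?(hdue j) // !inE.
  have next (x : 'I_n * time p) : (x.1 < i.+1) = (x.1 < i) || (x.1 == j).
    by rewrite -val_eqE /= ltnS leq_eqVlt orbC.
  apply: run_if; rewrite /= ji due' ts' addn1 => ju; last first.
    apply: run_skip; apply: Jext Ji => x /andP[xu _]; rewrite next.
    by case: eqP => [xj|_]; rewrite ?orbF // -xj xu in ju *.
  (* Pairs are visited in lexicographic order. *)
  pose I' (k : nat) := J (fun x => (x.1 < i) || (x.1 == j) && (x.2 < k)).
  apply: (run_frame (run_for (I := I') (N := (horizon p).+1) _ _ _ _ _ _)) => //.
  + by rewrite /= mem_cat orbF.
  + move=> m1 /sub' s1 /=; rewrite addn1 s1.1 ?inE // sm.1 ?inE ?T0 //.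
  + by move=> k m1 v; exact: Jt.
  + by apply: Jext Ji => x _; rewrite andbF orbF.
  + move=> k m1 ltk /sub' s1 tk Jk; pose t : time p := Ordinal ltk.
    have ts1 : nmem m1 tstar 0 0 = u by rewrite s1.1 // !inE.
    have next' (x : 'I_n * time p) : (x.1 < i) || (x.1 == j) && (x.2 < k.+1) =
        predU1 (j, t) (fun x => (x.1 < i) || (x.1 == j) && (x.2 < k)) x.
      by case: x => x1 x2; rewrite /= xpair_eqE -!val_eqE /=; lia.
    apply: run_if => /=; rewrite tk ts1 => ut; last first.
      apply: run_skip; apply: Jext Jk => x /andP[_ xu]; rewrite next' /=.
      by case: (x =P (j, t)) => // E; rewrite E /= (negPf ut) in xu.
    apply: (run_frame (step (fun x => (x.1 < i) || (x.1 == j) && (x.2 < k))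
       (j, t) _ _ _ _ _ _ _)) => //.
    * apply: same_trans sm _; apply: same_sub s1 => // y.
      by rewrite !inE => /orP[] ->; rewrite ?orbT.
    * by rewrite s1.1 // inE.
    * by rewrite /eligible /= ju.
    * by rewrite /= ltnn eqxx ltnn.
    * by move=> m2 _; apply: Jext => x _; rewrite next'.
  + by move=> m1 _; apply: Jext => x _; rewrite next ltn_ord andbT.
- by move=> m' _; apply: Jext => x _; exact: ltn_ord.
Qed.

Lemma neval_Trunc m sigma (u : time p) (j : 'I_n) :
  holds_instance m -> nmem m best 0 0 = demand u sigma -> nmem m jvar 0 0 = j ->
  neval m Trunc = trunc_p j u sigma.
Proof. by move=> [_ _ pE] bE jE; rewrite /= jE pE bE /trunc_p; lia. Qed.

Definition ratio sigma (u : time p) g (x : 'I_n * time p) : R :=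
  (g x.1 x.2 / (trunc_p x.1 u sigma)%:R)%R.

Lemma run_select m sigma g (u : time p) :
  holds_instance m -> holds_due m sigma -> holds_costs m g ->
  nmem m tstar 0 0 = u -> nmem m best 0 0 = demand u sigma ->
  (exists x, eligible sigma u x) ->
  run M Select m (fun m' => exists x,
    [/\ eligible sigma u x, nmem m' bestj 0 0 = x.1, nmem m' bests 0 0 = x.2,
        rmem m' alpha 0 0 = ratio sigma u g x
      & forall y, eligible sigma u y ->
          (ratio sigma u g x <= ratio sigma u g y)%R]).
Proof.
move=> inst hdue hg uE bE [x0 x0u]; apply/run_seq/run_nset => /=.
set m0 := Memory _ _.
have s0 : same [:: found] [::] m m0 by apply: same_put.
have inst0 : holds_instance m0 by apply: holds_instance_same s0 _.
have hdue0 : holds_due m0 sigma by apply: holds_due_same s0 _.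
pose J (A : pred ('I_n * time p)) (m' : memory R) :=
  (forall x, A x -> eligible sigma u x ->
     0 < nmem m' found 0 0 /\ (rmem m' alpha 0 0 <= ratio sigma u g x)%R) /\
  (0 < nmem m' found 0 0 -> exists x,
     [/\ eligible sigma u x, nmem m' bestj 0 0 = x.1, nmem m' bests 0 0 = x.2
       & rmem m' alpha 0 0 = ratio sigma u g x]).
apply: (run_frame (run_for_eligible (J := J) (sigma := sigma) (u := u) _ _ _ _ _
  _ _ _ _ _ _)) => //.
- move=> A B m' AB [mn wit]; split=> // x Bx xu; apply: mn => //.
  by rewrite AB.
- move=> A x m' sm jx tx xu _ [mn wit].
  have inst' : holds_instance m' by apply: holds_instance_same sm inst0.
  have b' : nmem m' best 0 0 = demand u sigma by rewrite sm.1.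
  have tr := neval_Trunc inst' b' jx.
  have rat : reval m' (RDiv CurG Trunc) = ratio sigma u g x.
    transitivity (rmem m' gcell (nmem m' jvar 0 0) (nmem m' tvar 0 0) /
      (neval m' Trunc)%:R)%R; first by [].
    by rewrite tr jx tx sm.2 // hg.
  have rec : (forall y, A y -> eligible sigma u y ->
       (ratio sigma u g x <= ratio sigma u g y)%R) ->
      run M Record m' (J (predU1 x A)).
    move=> le_x; apply/run_seq/run_rset/run_seq/run_nset/run_seq/run_nset/run_nset.
    rewrite rat; split=> /= [y /orP[/eqP->|Ay] yu|_]; first by split.
      by split=> //; apply: le_x.
    by exists x.
  apply: run_if => /= f0.
    by apply: rec => y Ay yu; have [] := mn y Ay yu; rewrite ltnNge f0.
  rewrite -ltnNge in f0; apply: run_if; rewrite /teval rat => le_x.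
    apply: rec => y Ay yu; apply: le_trans le_x _.
    by have [] := mn y Ay yu.
  apply: run_skip; split=> // y /orP[/eqP->|Ay] yu; last exact: mn.
  by split=> //; apply: ltW; rewrite ltNge.
- move=> m' _ [mn wit]; have [f0 _] := mn x0 isT x0u.
  have [x [xu xj xs xa]] := wit f0; exists x; split=> // y yu.
  by rewrite -xa; have [] := mn y isT yu.
Qed.

Lemma run_reduce m sigma g (u : time p) (a : R) :
  holds_instance m -> holds_due m sigma -> holds_costs m g ->
  nmem m tstar 0 0 = u -> nmem m best 0 0 = demand u sigma ->
  rmem m alpha 0 0 = a ->
  run M Reduce m (fun m' => holds_costs m' (residual g (ghat R sigma u) a)).
Proof.
move=> inst hdue hg uE bE aE.
(* Visited eligible cells hold the residual and all others the old cost. At the end this is the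
   residual everywhere, since [ghat] is zero off the eligible pairs. *)
pose J (A : pred ('I_n * time p)) (m' : memory R) :=
  forall x : 'I_n * time p, rmem m' gcell x.1 x.2 =
    if A x && eligible sigma u x then residual g (ghat R sigma u) a x.1 x.2
    else g x.1 x.2.
apply: (run_frame (run_for_eligible (J := J) (sigma := sigma) (u := u) _ _ _ _ _
  _ _ _ _ _ _)) => //.
- move=> A B m' AB JA x; rewrite JA; case: (boolP (eligible _ _ _)) => xu.
    by rewrite AB.
  by rewrite !andbF.
- move=> A x m' sm jx tx xu nAx JA.
  have inst' : holds_instance m' by apply: holds_instance_same sm inst.
  have b' : nmem m' best 0 0 = demand u sigma by rewrite sm.1.
  have tr := neval_Trunc inst' b' jx.
  have a' : rmem m' alpha 0 0 = a by rewrite sm.2.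
  apply: run_rset => y.
  have -> : reval m' (RSub CurG (RMul Alpha Trunc)) =
      residual g (ghat R sigma u) a x.1 x.2.
    transitivity (rmem m' gcell (nmem m' jvar 0 0) (nmem m' tvar 0 0) -
      rmem m' alpha 0 0 * (neval m' Trunc)%:R)%R; first by [].
    rewrite tr jx tx JA (negPf nAx) a'.
    by have /andP[xu1 xu2] := xu; rewrite /residual /ghat xu1 xu2.
  rewrite /= jx tx /write /=.
  have -> : (y.1 == x.1 :> nat) && (y.2 == x.2 :> nat) = (y == x).
    by case: (x) (y) => [x1 x2] [y1 y2]; rewrite xpair_eqE -!val_eqE.
  by case: eqP => [->|_]; rewrite ?xu //= JA.
- move=> m' _ Jm' j t; rewrite (Jm' (j, t)) /=.
  case: (boolP (eligible sigma u (j, t))) => //=.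
  by rewrite /eligible /residual /ghat /= => /negPf->; rewrite mulr0 subr0.
Qed.

(* The recursive calls in progress, innermost last: the job chosen in the call
   and its due date on entry. *)
Definition holds_stack m (l : seq ('I_n * time p)) : Prop :=
  nmem m depth 0 0 = size l /\
  forall x0 k, k < size l ->
    nmem m stackj k 0 = (nth x0 l k).1 /\ nmem m stackd k 0 = (nth x0 l k).2.

Lemma holds_stack_same ln lr m m' l :
  all (fun a => a \notin ln) [:: depth; stackj; stackd] -> same ln lr m m' ->
  holds_stack m l -> holds_stack m' l.
Proof.
move=> /and4P[ld lj ls _] [nE _] [md mE]; split=> [|x0 k ltk]; rewrite !nE //.
exact: mE.
Qed.

Lemma run_push m sigma l (x : 'I_n * time p) :
  holds_due m sigma -> holds_stack m l ->
  nmem m bestj 0 0 = x.1 -> nmem m bests 0 0 = x.2 ->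
  run M Push m (fun m' => holds_due m' (update sigma x.1 x.2) /\
    holds_stack m' (rcons l (x.1, sigma x.1))).
Proof.
move=> hdue [md mE] xj xs.
apply/run_seq/run_nset/run_seq/run_nset/run_seq/run_nset/run_nset => /=.
rewrite /write /= xj xs md hdue; split=> [i|].
  rewrite ffunE /= andbT -val_eqE; case: ifP => // _; exact: hdue.
split=> /= [|x0 k]; rewrite size_rcons ?addn1 // ltnS leq_eqVlt nth_rcons andbT.
by case: eqP => [->|_] /=; [rewrite ltnn|move=> ltk; rewrite ltk; apply: mE].
Qed.

Definition restore (x : 'I_n * time p) rho : assignment p :=
  if feasibleb (update rho x.1 x.2) then update rho x.1 x.2 else rho.

(** A right fold, because the innermost call sits last in [l] and returns first. *)
Definition unwind (l : seq ('I_n * time p)) rho : assignment p :=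
  foldr restore rho l.

Lemma unwind_rcons l x rho : unwind (rcons l x) rho = unwind l (restore x rho).
Proof. exact: foldr_rcons. Qed.

Lemma local_ratio_restore sigma g j s g' rho :
  lr_step sigma g j s g' -> local_ratio (update sigma j s) g' rho ->
  local_ratio sigma g (restore (j, sigma j) rho).
Proof.
rewrite /restore => st lr; case: (feasibleP (update rho j (sigma j))) => /= feas.
  exact: LR_restore st lr feas.
exact: LR_keep st lr feas.
Qed.

(** * The descending and the unwinding loop *)

Section Run.

Variables (sigma0 : assignment p) (g0 : costs p R).
Hypothesis M_large : n * horizon p <= M.

(** The stack seen as a continuation of the current call; it relates the loop to the recursion while
    no result is known yet. *)
Definition returns_to l sigma g : Prop :=
  forall rho, local_ratio sigma g rho -> local_ratio sigma0 g0 (unwind l rho).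

(** The slack bounds the remaining iterations. Its sum with the stack size limits the final stack,
    hence the length of the unwinding. *)
Definition descend_inv (k : nat) m : Prop := exists sigma g l,
  [/\ holds_instance m, holds_due m sigma, holds_costs m g & holds_stack m l] /\
  [/\ nonneg_costs g, max_demand_spec sigma m, returns_to l sigma g,
      slack sigma <= k & slack sigma + size l <= n * horizon p].

Definition unwind_inv (k : nat) m : Prop := exists sigma l,
  [/\ holds_instance m, holds_due m sigma, holds_stack m l,
      local_ratio sigma0 g0 (unwind l sigma) & size l = k].

Lemma run_descend m k :
  descend_inv k m -> k <= M ->
  run M Descend m (fun m' => exists2 l, l <= M & unwind_inv l m').
Proof.
move=> inv lek; apply: (run_while _ _ lek inv) => {m k inv lek} k m; last first.
  move=> [sigma [g [l [[inst hdue hg hst] [_ spec ret lek le_s]]]]] /=.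
  rewrite -eqn0Ngt => /eqP/(spec.1) feas.
  exists (size l).
    by apply: leq_trans (leq_trans _ le_s) M_large; rewrite leq_addl.
  by exists sigma, l; split=> //; apply: ret; constructor.
move=> [sigma [g [l [[inst hdue hg hst] [g_ge0 spec ret lek le_s]]]]] /= b0.
have [u [uE amax dE]] := spec.2 b0.
have du : 0 < demand u sigma by rewrite dE.
have [i iu] := demand_gt0_job du amax.1.
have elig0 : exists x, eligible sigma u x.
  by exists (i, u); rewrite /eligible /= iu leqnn.
have st x : eligible sigma u x -> (forall y, eligible sigma u y ->
      (ratio sigma u g x <= ratio sigma u g y)%R) ->
    lr_step sigma g x.1 x.2 (residual g (ghat R sigma u) (ratio sigma u g x)).
  move=> /andP[xu ux] minx.
  apply: (lr_step_min p_gt0 g_ge0 amax du xu ux) => i' t i'u ut.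
  by apply: (minx (i', t)); rewrite /eligible /= i'u ut.
(* Job [i] is due before [u], so before T, and contributes to the slack. *)
have k0 : 0 < k.
  apply: leq_trans lek; rewrite /slack (bigD1 i) //= ltn_addr // subn_gt0.
  by apply: leq_trans iu _; rewrite -ltnS ltn_ord.
split=> //; apply: run_seq.
apply: (run_frame (run_select inst hdue hg uE (esym dE) elig0)).
move=> m1 s1 [x [xu xj xs xa minx]]; have stx := st x xu minx.
have inst1 : holds_instance m1 by apply: holds_instance_same s1 inst.
have hdue1 : holds_due m1 sigma by apply: holds_due_same s1 hdue.
have hg1 : holds_costs m1 g by apply: holds_costs_same s1 hg.
have hst1 : holds_stack m1 l by apply: holds_stack_same s1 hst.
apply: run_seq; apply: (run_frame (run_reduce (u := u) inst1 hdue1 hg1 _ _ xa)).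
- by rewrite s1.1.
- by rewrite s1.1.
move=> m2 s2 hg2.
have inst2 : holds_instance m2 by apply: holds_instance_same s2 inst1.
have hdue2 : holds_due m2 sigma by apply: holds_due_same s2 hdue1.
have hst2 : holds_stack m2 l by apply: holds_stack_same s2 hst1.
apply: run_seq; apply: (run_frame (run_push (x := x) hdue2 hst2 _ _)).
- by rewrite s2.1.
- by rewrite s2.1.
move=> m3 s3 [hdue3 hst3].
have inst3 : holds_instance m3 by apply: holds_instance_same s3 inst2.
have hg3 := holds_costs_same (isT : gcell \notin rwrites Push) s3 hg2.
apply: (run_frame (run_max_demand inst3 hdue3)) => m4 s4 spec4.
have lt_s := slack_update (lr_step_increases stx).
exists (update sigma x.1 x.2), (residual g (ghat R sigma u) (ratio sigma u g x)).
exists (rcons l (x.1, sigma x.1)); split; split=> //.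
- exact: holds_instance_same s4 inst3.
- exact: holds_due_same s4 hdue3.
- exact: holds_costs_same s4 hg3.
- exact: holds_stack_same s4 hst3.
- exact: lr_step_nonneg stx.
- move=> rho lr; rewrite unwind_rcons; apply: ret.
  exact: local_ratio_restore stx lr.
- by rewrite -ltnS prednK //; apply: leq_trans lek.
- by rewrite size_rcons addnS; apply: leq_trans le_s; rewrite ltn_add2r.
Qed.

Lemma run_unwind m k :
  unwind_inv k m -> k <= M -> run M Unwind m (unwind_inv 0).
Proof.
move=> inv lek; apply: (run_while _ _ lek inv) => {m k inv lek} k m; last first.
  move=> [sigma [l [inst hdue hst lr szl]]]; rewrite /= hst.1 szl -eqn0Ngt.
  by move=> /eqP k0; exists sigma, l; rewrite szl.
move=> [sigma [l [inst hdue hst lr szl]]]; rewrite /= hst.1 szl => k0.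
split=> //; case/lastP: l => [|l x] in hst lr szl *; first by rewrite -szl in k0.
rewrite size_rcons in szl; rewrite -{}szl {k k0} /=.
have [dE sE] := hst; rewrite size_rcons in dE sE.
have [jE oE] := sE x _ (ltnSn _); rewrite nth_rcons ltnn eqxx in jE oE.
apply/run_seq/run_nset/run_seq/run_nset/run_seq/run_nset/run_seq.
rewrite /= /write /= dE subn1 /= jE oE hdue.
set m0 := Memory _ _.
have hdue0 : holds_due m0 (update sigma x.1 x.2).
  by move=> i; rewrite /= ffunE andbT -val_eqE; case: ifP => // _; exact: hdue.
have hst0 : holds_stack m0 l.
  split=> //= x0 i lti; have := sE x0 i (ltnW lti).
  by rewrite nth_rcons lti.
have inst0 : holds_instance m0 by [].
have saved0 : nmem m0 saved 0 0 = sigma x.1 by [].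
have job0 : nmem m0 stackj (nmem m0 depth 0 0) 0 = x.1 by [].
move: m0 hdue0 hst0 inst0 saved0 job0 => m0 hdue0 hst0 inst0 saved0 job0.
apply: (run_frame (run_max_demand inst0 hdue0)) => m1 s1 [spec0 spec1].
have inst1 : holds_instance m1 by apply: holds_instance_same s1 inst0.
have hdue1 : holds_due m1 (update sigma x.1 x.2) by apply: holds_due_same s1 hdue0.
have hst1 : holds_stack m1 l by apply: holds_stack_same s1 hst0.
rewrite unwind_rcons /restore in lr.
apply: run_if => /= b1.
  (* A positive demand refutes feasibility of the tentative assignment, so [restore] is the identity
     here, and writing [saved] back recovers [sigma]. *)
  apply: run_nset; exists sigma, l; split=> // [i|].
    rewrite /= !s1.1 // job0 saved0 /write /= andbT; case: eqP => [/val_inj->//|ij].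
    by rewrite hdue1 ffunE -val_eqE; case: eqP.
  have [u [_ amax du]] := spec1 b1; move: lr.
  case: (feasibleP (update sigma x.1 x.2)) => // feas.
  by have := feasible_demand feas amax.1; rewrite du => b0; rewrite b0 in b1.
apply: run_skip; exists (update sigma x.1 x.2), l; split=> //.
rewrite -eqn0Ngt in b1; move: lr.
by have /feasibleP -> := spec0 (eqP b1).
Qed.

End Run.

Lemma run_schedule m rho :
  holds_instance m -> holds_due m rho ->
  run M Schedule m (fun m' => forall j : 'I_n,
    nmem m' start j 0 = due_date_schedule p (fun j => rho j) j).
Proof.
move=> inst hdue.
pose I k m' := forall j : 'I_n, j < k ->
  nmem m' start j 0 = due_date_schedule p (fun j => rho j) j.
apply: (run_frame (run_for (I := I) (N := n) _ _ _ _ _ _)) => //.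
- by move=> m' sm /=; rewrite sm.1 //; case: inst.
- move=> i m' lti sm ti Ii; pose j := Ordinal lti.
  have inst' : holds_instance m' by apply: holds_instance_same sm inst.
  have hdue' : holds_due m' rho by apply: holds_due_same sm hdue.
  apply: run_seq.
  apply: (run_frame (run_sum (N := n)
     (P := fun k => nmem m' due k 0 + (i <= k) <= rho j)
     (F := fun k => nmem m' proc k 0) _ _ _ _)) => //.
  + by move=> m1 s1 /=; rewrite s1.1 //; case: inst'.
  + move=> m1 k ltk s1 k1; rewrite /= k1 !s1.1 // ti (hdue' j); split=> //.
    by congr (_ + _ <= _); lia.
  move=> m1 s1 acc1; apply: run_nset => k; rewrite /= s1.1 // ti /write /= andbT.
  rewrite ltnS leq_eqVlt; case: eqP => [E _|_] /=.
    rewrite acc1 /due_date_schedule; have -> : k = j by apply: val_inj.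
    rewrite (eq_bigl (fun l => due_date_lt (fun j => rho j) l j)) => [|l].
      by apply: eq_bigr => l _; case: inst'.
    by rewrite /due_date_lt hdue'.
  by move=> ltk; rewrite s1.1 //; exact: Ii.
- by move=> m' _ Im' j; exact: Im'.
Qed.

End Program.

(** The three bounds on [M] match the loops: over jobs, over times (T + 1 of them in [ForEligible],
    hence the strict inequality), and over steps of the recursion. *)
Lemma run_LocalRatio (R : realFieldType) (n : nat) (p : 'I_n -> nat)
    (f : 'I_n -> nat -> nat) (M : nat) :
  (forall j, 0 < p j) -> n <= M -> horizon p < M -> n * horizon p <= M ->
  run M LocalRatio (input R p f) (fun m => exists rho : assignment p,
    [/\ local_ratio (sigma_init p) (costs_init R f) rho,
        holds_due m rho
      & forall j : 'I_n,
          nmem m start j 0 = due_date_schedule p (fun j => rho j) j]).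
Proof.
move=> p_gt0 n_le T_lt nT_le; apply: run_seq.
apply: (run_frame (run_sum (N := n) (P := xpredT)
  (F := fun j => nmem (input R p f) proc j 0) _ _ _ _)) => //.
- by move=> m' s' /=; rewrite s'.1.
- by move=> m' i lti s' i1; rewrite /= i1 s'.1.
have proc0 (j : 'I_n) : nmem (input R p f) proc j 0 = p j by rewrite /= valK.
move=> m1 s1 T1.
have inst1 : holds_instance p m1.
  split=> [||j]; [by rewrite s1.1| |by rewrite s1.1 ?proc0].
  by rewrite T1 /horizon; apply: eq_bigr => j _; exact: proc0.
have hdue1 : holds_due m1 (sigma_init p) by move=> j; rewrite s1.1 // ffunE.
have hg1 : holds_costs (p := p) m1 (costs_init R f).
  by move=> j t; rewrite s1.2 //= -ltnS ltn_ord valK.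
have hst1 : holds_stack (p := p) m1 [::] by split=> //; rewrite s1.1.
apply: run_seq; apply: (run_frame (run_max_demand n_le T_lt inst1 hdue1)).
move=> m2 s2 spec2; apply: run_seq.
have inv : descend_inv (sigma_init p) (costs_init R f) (n * horizon p) m2.
  exists (sigma_init p), (costs_init R f), [::]; split; split=> //.
  - exact: holds_instance_same s2 inst1.
  - exact: holds_due_same s2 hdue1.
  - exact: holds_costs_same s2 hg1.
  - exact: holds_stack_same s2 hst1.
  - exact: slack_le.
  - by rewrite addn0 slack_le.
apply: (run_frame (run_descend p_gt0 n_le T_lt nT_le inv nT_le)).
move=> m3 _ [k lek inv3].
apply: run_seq; apply: (run_frame (run_unwind n_le T_lt inv3 lek)) => m4 _.
case=> rho [l [inst4 hdue4 _ lr /size0nil l0]]; rewrite l0 in lr.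
apply: (run_frame (run_schedule n_le T_lt inst4 hdue4)) => m5 s5 start5.
by exists rho; split=> //; apply: holds_due_same s5 hdue4.
Qed.

Theorem theorem12 (R : realFieldType) :
  (exists (prog : cmd) (c k : nat),
     forall (n : nat) (p : 'I_n -> nat) (f : 'I_n -> nat -> nat),
       valid_instance p f ->
       exists (m : memory R) (steps : nat) (rho : assignment p) (S : 'I_n -> nat),
         [/\ exec prog (input R p f) m steps,
             (steps <= c * (n + horizon p).+1 ^ k)%N,
             local_ratio (sigma_init p) (costs_init R f) rho /\
             outputs m 2 (fun j => rho j : nat)
           & [/\ is_schedule p S, meets S rho & outputs m 3 S]]) /\
  (exists (c k : nat),
     forall (n : nat) (p : 'I_n -> nat) (f : 'I_n -> nat -> nat),
       valid_instance p f ->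
       halts_within (c * (n + horizon p).+1 ^ k)%N
         (sigma_init p) (costs_init R f)) /\
  (forall (n : nat) (p : 'I_n -> nat) (f : 'I_n -> nat -> nat),
     valid_instance p f ->
     exists opt : nat,
       optimal_cost p f opt /\
       forall rho : assignment p,
         local_ratio (sigma_init p) (costs_init R f) rho ->
         [/\ feasible rho,
             forall S : 'I_n -> nat,
               is_schedule p S -> meets S rho ->
               (sched_cost p f S <= 4 * opt)%N
           & forall pos : {perm 'I_n},
               due_date_order rho pos ->
               is_schedule p (list_schedule p pos) /\
               meets (list_schedule p pos) rho]).
Proof.
have bound n T : n * T < (n + T).+1 ^ 2 by rewrite expnS expn1; nia.
split; [|split].
- have [a [k costP]] := cost_poly LocalRatio.
  (* The exponent doubles because the iteration bound [M] is itself a square, chosen to exceed n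
     T. *)
  exists LocalRatio, a, (2 * k) => n p f [p_gt0 _ _].
  pose M := (n + horizon p).+1 ^ 2.
  have leM : (n + horizon p).+1 <= M by rewrite /M expnS expn1 leq_pmulr.
  have [||m [steps [ex le_s [rho [lr hdue hS]]]]] :=
    run_LocalRatio R f (M := M) p_gt0 _ _ (ltnW (bound _ _)).
  + by apply: leq_trans leM; rewrite -addnS leq_addr.
  + by apply: leq_trans leM; rewrite ltnS leq_addl.
  exists m, steps, rho, (due_date_schedule p (fun j => rho j)); split=> //.
    by rewrite expnM; apply: leq_trans le_s (costP _ _); rewrite expn_gt0.
  split=> //; first exact: due_date_schedule_disjoint.
  apply: demand0_due_date_schedule => t; apply: feasible_demand.
  by case: (local_ratio_minimal lr).
(* The initial slack is at most n T, which is below the square of n + T + 1. *)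
- exists 1, 2 => n p f [p_gt0 _ _]; apply: halts_within_slack => //.
  by rewrite mul1n; apply: leq_ltn_trans (slack_le _) (bound _ _).
move=> n p f valid; have [tau feas_tau opt_tau] := exists_optimal_assignment valid.
exists (\sum_j f j (tau j)); split=> // rho lr.
have [feas _ _] := local_ratio_minimal lr; split=> // [S _ leS|pos].
  apply: leq_trans (sched_cost_meets valid leS) _.
  exact: (local_ratio_4_approx valid lr).
exact: list_schedule_feasible.
Qed.
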